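(* Let $C$ be a real number and let $(\bm Q^*,r^*_{ij},s^*_{ij},u^*_{ij},v^*_{ij})$ be an optimal solution of (DREG). Then for all $i\ne j$: 1. If $i\sim j$ and $Q^*_{ij}\le-1$, then $u^*_{ij}=0$ and $r^*_{ij}=-Q^*_{ij}$. 2. If $i\sim j$ and $Q^*_{ij}>-1$, then $u^*_{ij}=Q^*_{ij}+1$ and $r^*_{ij}=1$. 3. If $i\not\sim j$ and $Q^*_{ij}<1$, then $u^*_{ij}=1$ and $r^*_{ij}=1-Q^*_{ij}$. 4. If $i\not\sim j$ and $Q^*_{ij}\ge1$, then $u^*_{ij}=Q^*_{ij}$ and $r^*_{ij}=0$. Imposing these relations, (DREG) reduces to the following problem (DCREG), which agrees with (DREG) at optimality (the two problems have the same optimal value, and the same optimal matrices $\bm Q$): minimize $$\sum_{i\sim j,\ Q_{ij}>-1}Q_{ij}+\sum_{i\sim j,\ Q_{ij}\le -1}\bigl(-1-\log(-Q_{ij})\bigr)+\sum_{i\not\sim j,\ Q_{ij}\ge 1}\bigl(Q_{ij}-\log Q_{ij}-1\bigr)$$ over real symmetric $n\times n$ matrices $\bm Q\succeq0$ with $Q_{ii}=C$ for all $i$.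
   Context: $G=(V,E)$ is a simple undirected graph with $V=\{1,\dots,n\}$. For distinct $i,j$ write $i\sim j$ if $\{i,j\}\in E$ and $i\not\sim j$ otherwise; sums over $i\sim j$, $i\not\sim j$, $i\ne j$ are over ordered pairs of distinct indices. $\bm M\succeq0$ means $\bm M$ is real symmetric positive semidefinite. (DREG): minimize $\sum_{i\sim j}s_{ij}+\sum_{i\not\sim j}v_{ij}+\sum_{i\ne j}u_{ij}$ over a real symmetric $n\times n$ matrix $\bm Q$ and real numbers $r_{ij},u_{ij}$ ($i\ne j$), $s_{ij}$ ($i\sim j$), $v_{ij}$ ($i\not\sim j$), subject to $s_{ij}\ge -1-\log r_{ij}$ for $i\sim j$; $v_{ij}\ge -1-\log u_{ij}$ for $i\not\sim j$; $u_{ij}-r_{ij}=Q_{ij}$ and $u_{ij},r_{ij}\ge 0$ for $i\ne j$; $Q_{ii}=C$ for all $i$; $\bm Q\succeq0$ (with $-\log 0=+\infty$). *)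

(* Defs.v *)
From HB Require Import structures.
From mathcomp Require Import all_boot all_order all_algebra.
From mathcomp Require Import all_classical all_reals all_analysis.

Set Implicit Arguments.
Unset Strict Implicit.
Unset Printing Implicit Defensive.

Import Order.TTheory GRing.Theory Num.Theory.

Local Open Scope classical_set_scope.
Local Open Scope ring_scope.

Section Minimization.
Context {R : realType} {T : Type}.
Implicit Types (F : set T) (f : T -> R) (x : T).

Definition is_minimizer F f x := F x /\ forall y, F y -> f x <= f y.

Definition optimal_value F f : \bar R := ereal_inf [set (f x)%:E | x in F].

End Minimization.

Definition psdmx (R : realType) (n : nat) (Q : 'M[R]_n) :=
  Q^T = Q /\ forall x : 'cV[R]_n, 0 <= (x^T *m Q *m x) 0 0.

(* A graph on 'I_n is given by its adjacency relation e, assumed symmetric and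
   irreflexive where it is used. *)
Definition nonadj (n : nat) (e : rel 'I_n) : rel 'I_n :=
  [rel i j | (i != j) && ~~ e i j].

(* The families are total functions of (i, j), but only the entries
   r i j, u i j with i != j, s i j with e i j, and v i j with nonadj e i j are
   variables of the problem: no constraint, objective or relation below
   mentions any other entry. *)
Record dreg_point (R : realType) (n : nat) := DregPoint {
  dregQ : 'M[R]_n;
  dregr : 'I_n -> 'I_n -> R;
  dregs : 'I_n -> 'I_n -> R;
  dregu : 'I_n -> 'I_n -> R;
  dregv : 'I_n -> 'I_n -> R }.

Section Problems.
Context {R : realType} {n : nat} (e : rel 'I_n) (C : R).
Implicit Types (x : dreg_point R n) (Q : 'M[R]_n).

(* lne is the extended logarithm, with lne 0 = -oo; the real-valued ln of the
   library satisfies ln 0 = 0 and would admit r i j = 0 or u i j = 0. *)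
Definition dreg_feasible : set (dreg_point R n) := [set x |
  [/\ forall i j, e i j ->
        ((-1)%:E - lne (dregr x i j)%:E <= (dregs x i j)%:E)%E,
      forall i j, nonadj e i j ->
        ((-1)%:E - lne (dregu x i j)%:E <= (dregv x i j)%:E)%E,
      forall i j, i != j ->
        [/\ dregu x i j - dregr x i j = dregQ x i j,
            0 <= dregu x i j & 0 <= dregr x i j],
      forall i, dregQ x i i = C
    & psdmx (dregQ x)]].

Definition dreg_obj x : R :=
  \sum_(p : 'I_n * 'I_n | e p.1 p.2) dregs x p.1 p.2
  + \sum_(p : 'I_n * 'I_n | nonadj e p.1 p.2) dregv x p.1 p.2
  + \sum_(p : 'I_n * 'I_n | p.1 != p.2) dregu x p.1 p.2.

Definition dreg_relations x : Prop := forall i j, i != j ->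
  [/\ e i j -> dregQ x i j <= -1 ->
        dregu x i j = 0 /\ dregr x i j = - dregQ x i j,
      e i j -> -1 < dregQ x i j ->
        dregu x i j = dregQ x i j + 1 /\ dregr x i j = 1,
      nonadj e i j -> dregQ x i j < 1 ->
        dregu x i j = 1 /\ dregr x i j = 1 - dregQ x i j
    & nonadj e i j -> 1 <= dregQ x i j ->
        dregu x i j = dregQ x i j /\ dregr x i j = 0].

Definition dcreg_feasible : set 'M[R]_n :=
  [set Q | psdmx Q /\ forall i, Q i i = C].

Definition dcreg_obj Q : R :=
  \sum_(p : 'I_n * 'I_n | e p.1 p.2 && (-1 < Q p.1 p.2)) Q p.1 p.2
  + \sum_(p : 'I_n * 'I_n | e p.1 p.2 && (Q p.1 p.2 <= -1))
      (-1 - ln (- Q p.1 p.2))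
  + \sum_(p : 'I_n * 'I_n | nonadj e p.1 p.2 && (1 <= Q p.1 p.2))
      (Q p.1 p.2 - ln (Q p.1 p.2) - 1).

End Problems.

(* Main.v *)
(* For a fixed Q the problem decouples over the pairs (i, j).  Eliminating s and
   v, and u = r + Q i j on edges, the cost of a pair is
   Q i j + gap r with r >= - Q i j if i ~ j, and gap u with u >= Q i j
   otherwise, where gap t = t - 1 - ln t.  Since gap is strictly convex with
   minimum at 1, its unique minimizer over t >= a is max 1 a; this gives the
   four relations, and substituting them yields the objective of (DCREG). *)
Require Import Defs.
From mathcomp Require Import all_boot all_order all_algebra.
From mathcomp Require Import all_classical all_reals all_analysis.
From mathcomp Require Import ring lra.

Import Order.TTheory GRing.Theory Num.Theory.
Local Open Scope classical_set_scope.
Local Open Scope ring_scope.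

Section LogGap.
Context {R : realType}.
Implicit Types (a r s t : R).

Lemma ln_lt_subr1 t : 0 < t -> t != 1 -> ln t < t - 1.
Proof.
move=> t0 t1; rewrite -ltr_expR lnK ?posrE//.
by have := expR_gt1Dx (_ : t - 1 != 0); rewrite subrKC; apply; rewrite subr_eq0.
Qed.

Definition gap t : R := t - 1 - ln t.

Lemma gap1 : gap 1 = 0.
Proof. by rewrite /gap ln1 subr0 subrr. Qed.

(** With [m = max 1 a], [gap t - gap m] equals [gap (t / m) + (t - m) * (1 - m^-1)]. The first term
    is positive unless [t = m]; the second is nonnegative because either [m = 1] or [m = a <= t]. *)
Lemma gap_max1_leif a t : 0 < t -> a <= t ->
  gap (Num.max 1 a) <= gap t ?= iff (t == Num.max 1 a).
Proof.
move=> t0 at_; set m := Num.max 1 a.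
have m1 : 1 <= m by rewrite le_max lexx.
have m0 : 0 < m := lt_le_trans ltr01 m1.
apply/leifP; case: eqVneq => [->//|tm].
have tm0 : 0 < t / m by rewrite divr_gt0.
have tm1 : t / m != 1.
  by apply: contra_neq tm => /(congr1 ( *%R^~ m)); rewrite divfK ?gt_eqF// mul1r.
have := ln_lt_subr1 _ tm0 tm1; rewrite ln_div ?posrE//.
have : 0 <= (t - m) * (1 - m^-1).
  have [a1|a1] := leP a 1.
    have -> : m = 1 by rewrite /m; apply/max_idPl.
    by rewrite invr1 subrr mulr0.
  have -> : m = a by rewrite /m; apply/max_idPr/ltW.
  by apply: mulr_ge0; rewrite subr_ge0// invf_le1 ?ltW// (lt_trans ltr01).
rewrite mulrBr mulr1 mulrBl divff ?gt_eqF// /gap; lra.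
Qed.

(** At [r = 0] the left side is [+oo], so the extended constraint itself forces positivity and then
    becomes a real inequality. *)
Lemma lee_subN1_lne r s : 0 <= r ->
  ((-1)%:E - lne r%:E <= s%:E)%E = (0 < r) && (-1 - ln r <= s).
Proof.
rewrite le0r => /predU1P[->|r0]; first by rewrite le0_lneNy// ltxx.
by rewrite r0 lne_EFin// -EFinB lee_fin.
Qed.

End LogGap.

Section Reduction.
Context {R : realType} {n : nat} (e : rel 'I_n) (C : R).
Hypothesis e_irr : irreflexive e.
Implicit Types (x : dreg_point R n) (Q : 'M[R]_n) (i j : 'I_n) (q : R).

Definition pair_cost x i j : R :=
  dregu x i j + if e i j then dregs x i j else dregv x i j.

(** Least cost of a pair whose entry of [Q] is [q]; [b] tells whether the pair is an edge. *)
Definition reduced_cost (b : bool) q : R :=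
  if b then q + gap (Num.max 1 (- q)) else gap (Num.max 1 q).

Definition tight x i j : bool :=
  if e i j then
    (dregr x i j == Num.max 1 (- dregQ x i j))
      && (-1 - ln (dregr x i j) == dregs x i j)
  else
    (dregu x i j == Num.max 1 (dregQ x i j))
      && (-1 - ln (dregu x i j) == dregv x i j).

Lemma dreg_obj_pairs x :
  dreg_obj e x = \sum_(p : 'I_n * 'I_n | p.1 != p.2) pair_cost x p.1 p.2.
Proof.
rewrite /dreg_obj [X in X + _ + _]big_mkcond [X in _ + X + _]big_mkcond/=.
rewrite [X in _ + _ + X = _]big_mkcond [RHS]big_mkcond -!big_split/=.
apply: eq_bigr => -[i j] _; rewrite /nonadj/=.
have [->|ij] := eqVneq i j; first by rewrite e_irr !addr0.
by rewrite /pair_cost; case: (e i j) => /=; ring.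
Qed.

Lemma dcreg_obj_pairs Q : dcreg_obj e Q =
  \sum_(p : 'I_n * 'I_n | p.1 != p.2) reduced_cost (e p.1 p.2) (Q p.1 p.2).
Proof.
rewrite /dcreg_obj [X in X + _ + _]big_mkcond [X in _ + X + _]big_mkcond/=.
rewrite [X in _ + _ + X = _]big_mkcond [RHS]big_mkcond -!big_split/=.
apply: eq_bigr => -[i j] _; rewrite /nonadj/=.
have [->|ij] := eqVneq i j; first by rewrite e_irr !addr0.
rewrite /reduced_cost; case: (e i j) => /=.
  rewrite ltNge; have [q1|q1] := leP (Q i j) (-1) => /=.
    have /max_idPr -> : 1 <= - Q i j by lra.
    by rewrite /gap; ring.
  have /max_idPl -> : - Q i j <= 1 by lra.
  by rewrite gap1 !addr0.
rewrite !add0r; have [q1|q1] := leP 1 (Q i j) => /=.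
  by rewrite /gap; ring.
(* A non-edge with entry below 1 costs [gap 1 = 0], hence its absence from (DCREG). *)
by rewrite gap1.
Qed.

Lemma pair_cost_leif x i j : dreg_feasible e C x -> i != j ->
  reduced_cost (e i j) (dregQ x i j) <= pair_cost x i j ?= iff tight x i j.
Proof.
case=> adjx nonx pairx _ _ ij; have [qE u0 r0] := pairx i j ij.
rewrite /reduced_cost /pair_cost /tight; case: ifP => eij.
  have := adjx i j eij; rewrite lee_subN1_lne// => /andP[rgt0 sle].
  have qr : - dregQ x i j <= dregr x i j by rewrite -qE; lra.
  (* The intermediate value is the cost with [s] lowered to its bound [-1 - ln r]; the two equality
     cases are the conjuncts of [tight]. *)
  apply: (@leif_trans _ _ _ (dregQ x i j + gap (dregr x i j))).
    by rewrite (mono_leif (lerD2l _)); exact: gap_max1_leif.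
  have -> : dregQ x i j + gap (dregr x i j)
      = dregu x i j + (-1 - ln (dregr x i j)) by rewrite -qE /gap; ring.
  by rewrite (mono_leif (lerD2l _)); exact: leif_eq.
have := nonx i j; rewrite /nonadj/= ij eij lee_subN1_lne// => /(_ isT) /andP[ugt0 vle].
have qu : dregQ x i j <= dregu x i j by rewrite -qE; lra.
apply: (@leif_trans _ _ _ (gap (dregu x i j))); first exact: gap_max1_leif.
rewrite /gap -addrA (mono_leif (lerD2l _)); exact: leif_eq.
Qed.

Lemma dreg_obj_leif x : dreg_feasible e C x ->
  dcreg_obj e (dregQ x) <= dreg_obj e x
    ?= iff [forall (p | p.1 != p.2), tight x p.1 p.2].
Proof.
move=> Fx; rewrite dreg_obj_pairs dcreg_obj_pairs.
by apply: leif_sum => p; exact: pair_cost_leif.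
Qed.

Lemma tight_relations x : dreg_feasible e C x ->
  (forall i j, i != j -> tight x i j) -> dreg_relations e x.
Proof.
move=> [_ _ pairx _ _] tx i j ij; have [qE _ _] := pairx i j ij.
have := tx i j ij; rewrite /tight /nonadj/= ij.
case: (e i j) => /= /andP[/eqP mE _]; split=> // _ q1.
- have /max_idPr mQ : 1 <= - dregQ x i j by lra.
  by rewrite mQ in mE; split=> //; lra.
- have /max_idPl m1 : - dregQ x i j <= 1 by lra.
  by rewrite m1 in mE; split=> //; lra.
- by move: mE; rewrite (max_idPl (ltW q1)) => mE; split=> //; lra.
- by move: mE; rewrite (max_idPr q1) => mE; split=> //; lra.
Qed.

(** The point over [Q] at which every pair is tight. *)
Definition dreg_lift Q : dreg_point R n :=
  let r i j := if e i j then Num.max 1 (- Q i j) else Num.max 1 (Q i j) - Q i j in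
  let u i j := if e i j then Num.max 1 (- Q i j) + Q i j else Num.max 1 (Q i j) in
  DregPoint Q r (fun i j => -1 - ln (r i j)) u (fun i j => -1 - ln (u i j)).

Lemma dreg_lift_feasible Q : dcreg_feasible C Q -> dreg_feasible e C (dreg_lift Q).
Proof.
have max1_gt0 q : 0 < Num.max 1 q by rewrite lt_max ltr01.
move=> [psdQ diagQ]; split=> //= i j.
- by move=> ->; rewrite lee_subN1_lne ?lexx ?andbT ?ltW.
- by move=> /andP[_ /negPf ->]; rewrite lee_subN1_lne ?lexx ?andbT ?ltW.
- move=> _; case: (e i j); split; try by rewrite ltW.
  + by ring.
  + by rewrite -lerBlDr sub0r le_max lexx orbT.
  + by ring.
  + by rewrite subr_ge0 le_max lexx orbT.
Qed.

Lemma dreg_lift_tight Q i j : tight (dreg_lift Q) i j.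
Proof. by rewrite /tight/=; case: (e i j); rewrite !eqxx. Qed.

Lemma dreg_lift_relations Q :
  dcreg_feasible C Q -> dreg_relations e (dreg_lift Q).
Proof.
move=> FQ; apply: tight_relations (dreg_lift_feasible _ FQ) _ => i j _.
exact: dreg_lift_tight.
Qed.

Lemma dreg_lift_obj Q : dcreg_feasible C Q ->
  dreg_obj e (dreg_lift Q) = dcreg_obj e Q.
Proof.
move=> FQ; apply/esym/eqP; rewrite (dreg_obj_leif _ (dreg_lift_feasible _ FQ)).
by apply/forall_inP => p _; exact: dreg_lift_tight.
Qed.

Lemma dregQ_feasible x : dreg_feasible e C x -> dcreg_feasible C (dregQ x).
Proof. by case. Qed.

Lemma dreg_obj_ge x : dreg_feasible e C x -> dcreg_obj e (dregQ x) <= dreg_obj e x.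
Proof. by move=> Fx; rewrite (dreg_obj_leif _ Fx). Qed.

(** A minimizer costs no more than the lift of its own matrix, that is, than its lower bound
    [dcreg_obj e (dregQ x)]; equality then makes every pair tight. *)
Lemma minimizer_relations x :
  is_minimizer (dreg_feasible e C) (dreg_obj e) x -> dreg_relations e x.
Proof.
move=> [Fx minx]; apply: (tight_relations _ Fx) => i j ij.
have FQ := dregQ_feasible _ Fx.
have := minx _ (dreg_lift_feasible _ FQ); rewrite dreg_lift_obj//.
rewrite (ge_leif (dreg_obj_leif _ Fx)) => /forall_inP /(_ (i, j)) /=; exact.
Qed.

End Reduction.

Theorem lemma2p3 (R : realType) (n : nat) (e : rel 'I_n)
    (e_sym : symmetric e) (e_irr : irreflexive e) (C : R) :
  [/\ (* the four relations hold at every optimal solution of (DREG) *)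
      forall x : dreg_point R n,
        is_minimizer (dreg_feasible e C) (dreg_obj e) x -> dreg_relations e x,
      (* (DREG) with the relations imposed reduces to (DCREG): the feasible
         matrices are the same, and over each of them the least value of the
         objective is that of (DCREG) *)
      [set dregQ x | x in dreg_feasible e C `&` [set x | dreg_relations e x]]
        = dcreg_feasible C /\
      (forall Q : 'M[R]_n, dcreg_feasible C Q ->
        exists x : dreg_point R n,
          is_minimizer
            (dreg_feasible e C
             `&` [set y | dreg_relations e y /\ dregQ y = Q])
            (dreg_obj e) x
          /\ dreg_obj e x = dcreg_obj e Q),
      (* same optimal value *)
      optimal_value (dreg_feasible e C) (dreg_obj e)
        = optimal_value (dcreg_feasible C) (dcreg_obj e)
    & (* same optimal matrices *)
      forall Q : 'M[R]_n,
        (exists2 x : dreg_point R n,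
           is_minimizer (dreg_feasible e C) (dreg_obj e) x & dregQ x = Q)
        <-> is_minimizer (dcreg_feasible C) (dcreg_obj e) Q].
Proof.
pose liftF := @dreg_lift_feasible R n e C.
pose liftR := @dreg_lift_relations R n e C.
pose liftO := @dreg_lift_obj R n e C e_irr.
pose objge := @dreg_obj_ge R n e C e_irr.
split.
- exact: minimizer_relations.
- split.
    rewrite eqEsubset; split=> [_ [x [Fx _] <-]|Q FQ].
      exact: dregQ_feasible Fx.
    by exists (dreg_lift e Q) => //; split; [exact: liftF|exact: liftR].
  move=> Q FQ; exists (dreg_lift e Q); split; last exact: liftO.
  split; first by split; [exact: liftF|split=> //; exact: liftR].
  by move=> y [Fy [_ yQ]]; rewrite liftO// -yQ objge.
(* Lifting preserves the objective, and projecting to [dregQ] does not increase it. *)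
- apply/eqP; rewrite eq_le; apply/andP; split; apply: le_ereal_inf_tmp.
    move=> _ [Q FQ <-]; apply: ereal_inf_lbound.
    by exists (dreg_lift e Q); [exact: liftF|rewrite liftO].
  move=> _ [x Fx <-]; apply: (@le_trans _ _ (dcreg_obj e (dregQ x))%:E).
    by apply: ereal_inf_lbound; exists (dregQ x) => //; exact: dregQ_feasible Fx.
  by rewrite lee_fin objge.
- move=> Q; split=> [[x [Fx minx] <-]|[FQ minQ]].
    split=> [|Q' FQ']; first exact: dregQ_feasible Fx.
    by apply: le_trans (objge _ Fx) _; rewrite -(liftO _ FQ'); exact/minx/liftF.
  exists (dreg_lift e Q) => //; split=> [|y Fy]; first exact: liftF.
  rewrite liftO//; apply: le_trans (minQ _ (dregQ_feasible _ _ _ Fy)) _.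
  exact: objge.
Qed.
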